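(* Let $e=\{i,j\}$ be an edge with shared rank $q_e\le1$ and nondegenerate shared scalar range, with normal-form data $A_h\le B_h$, $\alpha_h$, and $L_h(t)=A_h+\alpha_ht$, $U_h(t)=B_h+\alpha_ht$ ($h=i,j$) as in the context. Assume $$L_h(-1)<0,\quad L_h(1)<0,\quad U_h(-1)>0,\quad U_h(1)>0\qquad(h=i,j).$$ Then $$\operatorname{conv}(\mathcal S_e)=G_e=\operatorname{conv}\bigl(\{-1\}\times C_i^-\times C_j^-\ \cup\ \{1\}\times C_i^+\times C_j^+\bigr),$$ where points are identified with tuples $(t,z_i,z_j,x_i,x_j)$ and the factors $C_h^\pm$ occupy the coordinates $(z_h,x_h)$.
   Context: **Edge data.** $\mathcal U=\{u\in\mathbb R^{n_0}\mid\underline u\le u\le\bar u\}$ is a nonempty box; $\bar W$ is a real matrix with $n_0$ columns and rows indexed by a finite set of (undecided) ReLU units; $\bar b$ is a bias vector; $S_h$ is the support of row $h$ of $\bar W$. Units $i\neq j$ form an edge $e$: $S_e=S_i\cap S_j\neq\emptyset$. $P_h=S_h\setminus S_e$. The shared rank is $q_e=\dim\operatorname{span}\{\bar W_{i,S_e}^\top,\bar W_{j,S_e}^\top\}$. **Normal form (when $q_e\le 1$).** Choose a nonzero $r_e\in\mathbb R^{S_e}$ and scalars $a_i,a_j$ with $\bar W_{h,S_e}=a_hr_e^\top$. Let $[\underline\tau_e,\overline\tau_e]$ be the range of $t_0=r_e^\top u_{S_e}$ over the box, with $\underline\tau_e<\overline\tau_e$ (nondegenerate). Put $t=\frac{2t_0-(\underline\tau_e+\overline\tau_e)}{\overline\tau_e-\underline\tau_e}\in[-1,1]$,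 $\alpha_h=a_h(\overline\tau_e-\underline\tau_e)/2$, $p_h=\bar W_{h,P_h}u_{P_h}+\bar b_h+a_h(\underline\tau_e+\overline\tau_e)/2$, and let $[A_h,B_h]$ be the range of $p_h$ over the box. The pre-activation of unit $h$ is then $z_h=p_h+\alpha_ht$. **Sets.** With $\mathrm{ReLU}(z)=\max\{z,0\}$, for $h\in\{i,j\}$: - $\mathcal S_h=\{(t,z_h,x_h)\mid t\in[-1,1],\ L_h(t)\le z_h\le U_h(t),\ x_h=\mathrm{ReLU}(z_h)\}$. - $C_h^\pm=\operatorname{conv}\{(L_h(\pm1),0),(0,0),(U_h(\pm1),U_h(\pm1))\}\subset\mathbb R^2$, in coordinates $(z_h,x_h)$. - $\mathcal S_e=\{(t,z_i,z_j,x_i,x_j)\mid(t,z_i,x_i)\in\mathcal S_i,\ (t,z_j,x_j)\in\mathcal S_j\}$. - $G_e=\{(t,z_i,z_j,x_i,x_j)\mid(t,z_i,x_i)\in\operatorname{conv}(\mathcal S_i),\ (t,z_j,x_j)\in\operatorname{conv}(\mathcal S_j)\}$. *)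

(* Defs.v *)
From HB Require Import structures.
From mathcomp Require Import all_boot all_order all_algebra.
From mathcomp Require Import all_classical all_reals all_analysis.

Set Implicit Arguments.
Unset Strict Implicit.
Unset Printing Implicit Defensive.

Import Order.TTheory GRing.Theory Num.Theory.

Local Open Scope ring_scope.

Definition conv_hull (R : numDomainType) (E : lmodType R) (X : set E) : set E :=
  smallest (@convex_set R E) X.

Definition relu (R : realType) (z : R) : R := Num.max z 0.

Section EdgeData.
Context (R : realType) (n0 m : nat).
Local Open Scope classical_set_scope.

Definition box (lo up : 'rV[R]_n0) : set 'rV[R]_n0 :=
  [set u : 'rV[R]_n0 | forall k, lo 0 k <= u 0 k <= up 0 k].

Definition dot n (u v : 'rV[R]_n) : R := \sum_k u 0 k * v 0 k.

(* The subvector v_S in R^S; S is enumerated by 'I_#|S|. *)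
Definition subvec (S : {set 'I_n0}) (v : 'rV[R]_n0) : 'rV[R]_#|S| :=
  \row_(k < #|S|) v 0 (enum_val k).

Implicit Types (W : 'M[R]_(m, n0)) (h i j : 'I_m).

Definition supp W h : {set 'I_n0} := [set k | W h k != 0]%SET.

Definition shared W i j : {set 'I_n0} := supp W i :&: supp W j.

Definition is_edge W i j : Prop := i != j /\ shared W i j != finset.set0.

Definition shared_rank W i j : nat :=
  \dim <<[:: subvec (shared W i j) (row i W); subvec (shared W i j) (row j W)]>>%VS.

Definition priv W (Se : {set 'I_n0}) h : {set 'I_n0} := supp W h :\: Se.

(* p_h = W_{h,P_h} u_{P_h} + b_h + a_h (tlo + tup) / 2, the last term recentring
   the shared scalar so that its normalisation t ranges over [-1, 1]. *)
Definition private_part W (b : 'cV[R]_m) (Se : {set 'I_n0}) (a tlo tup : R) h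
    (u : 'rV[R]_n0) : R :=
  dot (subvec (priv W Se h) (row h W)) (subvec (priv W Se h) u)
  + b h 0 + a * (tlo + tup) / 2.

End EdgeData.

Section EdgeSets.
Context (R : realType).
Local Open Scope classical_set_scope.

(* Coordinates: pt2 is (z_h, x_h), pt3 is (t, z_h, x_h) and pt5 is
   (t, z_i, z_j, x_i, x_j). *)
Definition pt2 : lmodType R := (R^o * R^o)%type.
Definition pt3 : lmodType R := (R^o * R^o * R^o)%type.
Definition pt5 : lmodType R := (R^o * R^o * R^o * R^o * R^o)%type.

Definition unit_set (L U : R -> R) : set pt3 :=
  [set p : pt3 | let: (t, z, x) := p in
    [/\ (-1 : R) <= t <= 1, L t <= z <= U t & x = relu z]].

Definition triangle (L U : R -> R) (s : R) : set pt2 :=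
  conv_hull ([set (L s, 0); (0, 0); (U s, U s)] : set pt2).

(* Fibre product over t: it yields S_e from S_i and S_j, and G_e from their
   convex hulls. *)
Definition couple (Xi Xj : set pt3) : set pt5 :=
  [set p : pt5 | let: (t, zi, zj, xi, xj) := p in Xi (t, zi, xi) /\ Xj (t, zj, xj)].

(* The set {s} x Ci x Cj, up to the order of coordinates. *)
Definition slice (s : R) (Ci Cj : set pt2) : set pt5 :=
  [set p : pt5 | let: (t, zi, zj, xi, xj) := p in
    [/\ t = s, Ci (zi, xi) & Cj (zj, xj)]].

End EdgeSets.

(* Main.v *)
(* Since L < 0 < U at both endpoints and L, U are affine in t, each unit's hull
   is the hull of {-1} x C^- and {1} x C^+: the vertices of the triangle at t
   interpolate those at -1 and 1.  In any convex combination of points of the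
   two end slices the weights are forced by t, so those for i and j coincide
   and the fibre product of the two hulls is the hull of the products of the
   end slices.  Finally each such product is spanned by pairs of vertices, and
   these lie in S_e. *)
Require Import Defs.
From mathcomp Require Import all_boot all_order all_algebra.
From mathcomp Require Import all_classical all_reals all_analysis.
From mathcomp Require Import ring lra.

Import Order.TTheory GRing.Theory Num.Theory.

Local Open Scope classical_set_scope.
Local Open Scope ring_scope.

Section ConvexHull.
Context {R : realFieldType} {E : lmodType R}.
Implicit Types X Y K : set E.

Lemma convex_setP K :
  @convex_set R E K <->
  (forall (l : R) x y, 0 <= l <= 1 -> K x -> K y -> K (l *: x + (1 - l) *: y)).
Proof.
split=> [cK l x y /andP[l0 l1] Kx Ky|cK x y l /set_mem Kx /set_mem Ky].
- exact: set_mem (cK x y (Itv01 l0 l1) (mem_set Kx) (mem_set Ky)).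
- by apply/mem_set; apply: cK => //; apply/andP.
Qed.

Lemma convex_conv_hull X : @convex_set R E (conv_hull X).
Proof.
apply/convex_setP => l x y l01 Xx Xy K [cK XK].
by move/convex_setP: (cK); apply=> //; [apply: Xx|apply: Xy].
Qed.

Lemma conv_hull_convex X (l : R) x y : 0 <= l <= 1 ->
  conv_hull X x -> conv_hull X y -> conv_hull X (l *: x + (1 - l) *: y).
Proof. by move: l x y; apply/convex_setP/convex_conv_hull. Qed.

Lemma sub_conv_hull X : X `<=` conv_hull X.
Proof. exact: sub_gen_smallest. Qed.

Lemma conv_hull_sub X K : @convex_set R E K -> X `<=` K -> conv_hull X `<=` K.
Proof. exact: smallest_sub. Qed.

(** Divide the weights by [p + q]; if the sum vanishes then so do both weights, and any point of [K]
    serves. This allows terms to be regrouped inside a convex set without first normalising them. *)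
Lemma convex_cone_comb K (p q : R) x y : @convex_set R E K ->
  0 <= p -> 0 <= q -> K x -> K y ->
  exists2 z, K z & p *: x + q *: y = (p + q) *: z.
Proof.
move=> /convex_setP cK p0 q0 Kx Ky.
have [pq0|pq0] := eqVneq (p + q) 0.
  have [-> ->] : p = 0 /\ q = 0 by split; lra.
  by exists x; rewrite // addr0 !scale0r addr0.
have pq_gt0 : 0 < p + q by rewrite lt_neqAle eq_sym pq0 addr_ge0.
exists (p / (p + q) *: x + (1 - p / (p + q)) *: y).
  by apply: cK; rewrite // ler_pdivrMr// mul1r lerDl q0 divr_ge0// ltW.
rewrite scalerDr !scalerA; congr (_ *: _ + _ *: _); by field.
Qed.

(** The two-point combinations already form a convex set: in a combination of two of them, the two
    points of [X] merge into one, and likewise those of [Y]. Nonemptiness supplies the partner of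
    weight 0 for a point of [X] or [Y] alone. *)
Lemma conv_hull_setU X Y : @convex_set R E X -> @convex_set R E Y ->
  X !=set0 -> Y !=set0 ->
  conv_hull (X `|` Y) `<=`
    [set z | exists l x y, [/\ 0 <= l <= 1, X x, Y y & z = l *: x + (1 - l) *: y]].
Proof.
move=> cX cY [x0 Xx0] [y0 Yy0]; apply: conv_hull_sub.
- apply/convex_setP=> k _ _ k01 [l [x [y [l01 Xx Yy ->]]]]
                           [l' [x' [y' [l'01 Xx' Yy' ->]]]].
  have [x2 Xx2 ex] : exists2 z, X z &
      (k * l) *: x + ((1 - k) * l') *: x' = (k * l + (1 - k) * l') *: z.
    by apply: convex_cone_comb => //; nra.
  have [y2 Yy2 ey] : exists2 z, Y z &
      (k * (1 - l)) *: y + ((1 - k) * (1 - l')) *: y'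
      = (k * (1 - l) + (1 - k) * (1 - l')) *: z.
    by apply: convex_cone_comb => //; nra.
  (* The new weight is the total weight carried by [X]; its complement is the total carried by
     [Y]. *)
  exists (k * l + (1 - k) * l'), x2, y2; split=> //; first by nra.
  rewrite !scalerDr !scalerA addrACA ex ey; congr (_ + _ *: _); ring.
- move=> z [Xz|Yz].
  + by exists 1, z, y0; rewrite subrr scale1r scale0r addr0 ler01 lexx.
  + by exists 0, x0, z; rewrite subr0 scale1r scale0r add0r ler01 lexx.
Qed.

End ConvexHull.

Section Edge.
Context {R : realType}.
Implicit Types (Xi Xj : set (pt3 R)) (C D Ci Cj Di Dj : set (pt2 R)).

Lemma convex_couple Xi Xj : @convex_set R (pt3 R) Xi -> @convex_set R (pt3 R) Xj ->
  @convex_set R (pt5 R) (couple Xi Xj).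
Proof.
move=> /convex_setP ci /convex_setP cj; apply/convex_setP.
move=> l [[[[t zi] zj] xi] xj] [[[[t' zi'] zj'] xi'] xj'] l01 [Xi1 Xj1] [Xi2 Xj2].
by split; [exact: (ci l _ _ l01 Xi1 Xi2)|exact: (cj l _ _ l01 Xj1 Xj2)].
Qed.

Definition slice1 (s : R) C : set (pt3 R) :=
  [set p : pt3 R | let: (t, z, x) := p in t = s /\ C (z, x)].

Lemma convex_slice1 s C : @convex_set R (pt2 R) C ->
  @convex_set R (pt3 R) (slice1 s C).
Proof.
move=> /convex_setP cC; apply/convex_setP.
move=> l [[t z] x] [[t' z'] x'] l01 [-> Cp] [-> Cq].
split; last exact: (cC l _ _ l01 Cp Cq).
by rewrite -scalerDl addrC subrK scale1r.
Qed.

(* The common coordinate [t] determines the weight of the slice [t = -1], so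
   both factors are decomposed with the same weight. *)
Lemma couple_conv_hull_slice1 Ci Cj Di Dj :
  @convex_set R (pt2 R) Ci -> @convex_set R (pt2 R) Cj ->
  @convex_set R (pt2 R) Di -> @convex_set R (pt2 R) Dj ->
  Ci !=set0 -> Cj !=set0 -> Di !=set0 -> Dj !=set0 ->
  couple (conv_hull (slice1 (-1) Ci `|` slice1 1 Di))
         (conv_hull (slice1 (-1) Cj `|` slice1 1 Dj)) `<=`
  conv_hull (slice (-1) Ci Cj `|` slice 1 Di Dj).
Proof.
move=> cCi cCj cDi cDj Ci0 Cj0 Di0 Dj0.
have slice1_neq0 s C : C !=set0 -> slice1 s C !=set0.
  by move=> [[z x] Czx]; exists (s, z, x).
move=> [[[[t zi] zj] xi] xj] [].
move=> /conv_hull_setU -/(_ (convex_slice1 _ _ cCi) (convex_slice1 _ _ cDi)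
                            (slice1_neq0 _ _ Ci0) (slice1_neq0 _ _ Di0)).
move=> [l [[[t1 z1] x1] [[[t2 z2] x2] [l01 [-> C1] [-> D2] [et -> ->]]]]].
move=> /conv_hull_setU -/(_ (convex_slice1 _ _ cCj) (convex_slice1 _ _ cDj)
                            (slice1_neq0 _ _ Cj0) (slice1_neq0 _ _ Dj0)).
move=> [l' [[[t1' z1'] x1'] [[[t2' z2'] x2'] [_ [-> C1'] [-> D2'] [et' -> ->]]]]].
have el : l' = l.
  move: et et'; rewrite /GRing.scale/= => -> ?; lra.
rewrite el et; apply: (@conv_hull_convex _ (pt5 R) _ l
  (-1, z1, z1', x1, x1') (1, z2, z2', x2, x2')) => //.
- by apply: sub_conv_hull; left.
- by apply: sub_conv_hull; right.
Qed.

(** One factor is convexified at a time, since sections of a convex set are convex: first [Vi] with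
    a vertex of [Vj] held fixed, then [Vj] with a point of the hull of [Vi] held fixed. *)
Lemma slice_conv_hull_sub (s : R) (Vi Vj : set (pt2 R)) (K : set (pt5 R)) :
  @convex_set R (pt5 R) K -> slice s Vi Vj `<=` K ->
  slice s (conv_hull Vi) (conv_hull Vj) `<=` K.
Proof.
move=> /convex_setP cK VK.
(* Writes each frozen coordinate as a combination of itself, so that convexity of [K] applies to its
   sections. *)
have ee (l x : R^o) : x = l *: x + (1 - l) *: x.
  by rewrite -scalerDl addrC subrK scale1r.
have Ki (w : pt2 R) : Vj w ->
    conv_hull Vi `<=` [set v : pt2 R | K (s, v.1, w.1, v.2, w.2)].
  move=> Vw; apply: conv_hull_sub => [|[z x] Vzx]; last first.
    by apply: VK; split=> //; rewrite -surjective_pairing.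
  apply/convex_setP => l v v' l01 /= Kv Kv'.
  by rewrite (ee l s) (ee l w.1) (ee l w.2); exact: (cK l _ _ l01 Kv Kv').
have Kij (v : pt2 R) : conv_hull Vi v ->
    conv_hull Vj `<=` [set w : pt2 R | K (s, v.1, w.1, v.2, w.2)].
  move=> Vv; apply: conv_hull_sub => [|w Vw]; last exact: (Ki w Vw v Vv).
  apply/convex_setP => l w w' l01 /= Kw Kw'.
  by rewrite (ee l s) (ee l v.1) (ee l v.2); exact: (cK l _ _ l01 Kw Kw').
by move=> [[[[t zi] zj] xi] xj] [-> Vi1 Vj1]; exact: (Kij _ Vi1 _ Vj1).
Qed.

Section Unit.
Context (A B al : R).
Let L (t : R) := A + al * t.
Let U (t : R) := B + al * t.
Hypotheses (LN0 : L (-1) < 0) (L0 : L 1 < 0) (UN0 : 0 < U (-1)) (U0 : 0 < U 1).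

Let endpoint (s : R) : (s = -1) \/ (s = 1) -> L s < 0 /\ 0 < U s.
Proof. by case=> ->. Qed.

Lemma triangle0 s : triangle L U s (0, 0).
Proof. by apply: sub_conv_hull; left; right. Qed.

(** The fraction [k] along the edge from the origin does not depend on [s], so one [k] can be used
    at both ends. *)
Lemma triangle_L s k : 0 <= k <= 1 -> triangle L U s (k * L s, 0).
Proof.
move=> k01; rewrite (_ : (_, _) = k *: ((L s, 0) : pt2 R) + (1 - k) *: 0).
  apply: conv_hull_convex => //; last exact: triangle0.
  by apply: sub_conv_hull; left; left.
by rewrite scaler0 addr0; congr pair; rewrite scaler0.
Qed.

Lemma triangle_U s k : 0 <= k <= 1 -> triangle L U s (k * U s, k * U s).
Proof.
move=> k01; rewrite (_ : (_, _) = k *: ((U s, U s) : pt2 R) + (1 - k) *: 0).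
  apply: conv_hull_convex => //; last exact: triangle0.
  by apply: sub_conv_hull; right.
by rewrite scaler0 addr0.
Qed.

(** A point of the ReLU graph over [t] lies on an edge issuing from the origin of the triangle at
    [t]. The points at the same fraction of the corresponding edges at -1 and 1 interpolate to it,
    because [L] and [U] are affine. *)
Lemma unit_set_sub_hull :
  unit_set L U `<=`
    conv_hull (slice1 (-1) (triangle L U (-1)) `|` slice1 1 (triangle L U 1)).
Proof.
move=> [[t z] x] [/andP[t1 t2] /andP[Lz zU] ->].
set H := conv_hull _.
(* The solution of [t = l * -1 + (1 - l) * 1]. *)
pose l := (1 - t) / 2.
have l01 : 0 <= l <= 1 by rewrite /l; apply/andP; split; lra.
have comb v w : triangle L U (-1) v -> triangle L U 1 w ->
    H (t, l * v.1 + (1 - l) * w.1, l * v.2 + (1 - l) * w.2).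
  move=> Cv Cw.
  rewrite (_ : (t, _, _) = l *: ((-1, v.1, v.2) : pt3 R)
                         + (1 - l) *: ((1, w.1, w.2) : pt3 R)).
    by apply: conv_hull_convex => //; apply: sub_conv_hull;
      [left|right]; split=> //; rewrite -surjective_pairing.
  have et : t = l * -1 + (1 - l) * 1 by rewrite /l; lra.
  by rewrite [in LHS]et.
have [z0|z0] := leP z 0.
(* Inactive case: the sign of [al] tells which end bounds [L t] from above, and [z / L t] is the
   fraction along the edge. *)
- have Lt : L t < 0 by move: LN0 L0; rewrite /L; case: (leP 0 al) => al0; nra.
  have k01 : 0 <= z / L t <= 1.
    by rewrite ler_ndivrMr // mul1r Lz andbT -mulrNN -invrN mulr_ge0//
      ?invr_ge0 oppr_ge0// ltW.
  have := comb _ _ (triangle_L (-1) _ k01) (triangle_L 1 _ k01).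
  rewrite /relu max_r//; congr (H (_, _, _)) => /=; last by ring.
  by rewrite !(mulrCA _ (z / L t)) -mulrDr /l /L; field; rewrite lt_eqF.
- have Ut : 0 < U t by move: UN0 U0; rewrite /U; case: (leP 0 al) => al0; nra.
  have k01 : 0 <= z / U t <= 1.
    by rewrite ler_pdivrMr// mul1r zU andbT divr_ge0// ltW.
  have := comb _ _ (triangle_U (-1) _ k01) (triangle_U 1 _ k01).
  rewrite /relu max_l ?ltW//; congr (H (_, _, _)) => /=.
  all: by rewrite !(mulrCA _ (z / U t)) -mulrDr /l /U; field; rewrite gt_eqF.
Qed.

(** The signs at the ends put the vertices on the ReLU graph: [L s < 0] is sent to 0, [U s > 0] is
    kept, and 0 lies between them. *)
Lemma vertices_sub_unit_set s (v : pt2 R) : s = -1 \/ s = 1 ->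
  ([set (L s, 0); (0, 0); (U s, U s)] : set (pt2 R)) v ->
  unit_set L U (s, v.1, v.2).
Proof.
move=> s1; have [Ls Us] := endpoint s s1.
have s01 : -1 <= s <= 1 by case: s1 => ->; lra.
by move=> [[|]|] -> /=; split=> //; rewrite /relu; try lra;
  [rewrite max_r// ltW|rewrite maxxx|rewrite max_l// ltW].
Qed.

End Unit.

End Edge.

Theorem theorem5p3 (R : realType) (n0 m : nat) (lo up : 'rV[R]_n0)
    (W : 'M[R]_(m, n0)) (b : 'cV[R]_m) (i j : 'I_m)
    (r : 'rV[R]_#|shared W i j|) (a : 'I_m -> R) (tlo tup : R)
    (A B : 'I_m -> R) :
  let Se := shared W i j in
  let alpha h := a h * (tup - tlo) / 2 in
  let L h t := A h + alpha h * t in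
  let U h t := B h + alpha h * t in
  let SS h := unit_set (L h) (U h) in
  let C h s := triangle (L h) (U h) s in
  box lo up !=set0 ->
  is_edge W i j ->
  (shared_rank W i j <= 1)%N ->
  r != 0 ->
  (forall h, h \in [:: i; j] -> subvec Se (row h W) = a h *: r) ->
  [set dot r (subvec Se u) | u in box lo up] = `[tlo, tup]%classic ->
  tlo < tup ->
  (forall h, h \in [:: i; j] ->
    [set private_part W b Se (a h) tlo tup h u | u in box lo up]
      = `[A h, B h]%classic) ->
  (forall h, h \in [:: i; j] ->
    [/\ L h (-1) < 0, L h 1 < 0, 0 < U h (-1) & 0 < U h 1]) ->
  conv_hull (couple (SS i) (SS j)) = couple (conv_hull (SS i)) (conv_hull (SS j))
  /\ couple (conv_hull (SS i)) (conv_hull (SS j))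
     = conv_hull (slice (-1) (C i (-1)) (C j (-1)) `|` slice 1 (C i 1) (C j 1)).
Proof.
move=> Se alpha L U SS C _ _ _ _ _ _ _ _ LU.
have ii : i \in [:: i; j] by rewrite !inE eqxx.
have jj : j \in [:: i; j] by rewrite !inE eqxx orbT.
have convC h s : @convex_set R (pt2 R) (C h s) by exact: convex_conv_hull.
have C0 h s : C h s !=set0 by exists (0, 0); exact: triangle0.
(* Both equalities follow from the cycle of inclusions [SG], [GT], [TS]. *)
have SG : conv_hull (couple (SS i) (SS j)) `<=`
          couple (conv_hull (SS i)) (conv_hull (SS j)).
  apply: conv_hull_sub; first by apply: convex_couple; exact: convex_conv_hull.
  by move=> [[[[t zi] zj] xi] xj] [Si Sj]; split; exact: sub_conv_hull.
have hullS h : h \in [:: i; j] -> conv_hull (SS h) `<=`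
    conv_hull (slice1 (-1) (C h (-1)) `|` slice1 1 (C h 1)).
  move=> /LU[LN L1 UN U1]; apply: conv_hull_sub; first exact: convex_conv_hull.
  exact: unit_set_sub_hull.
have GT : couple (conv_hull (SS i)) (conv_hull (SS j)) `<=`
    conv_hull (slice (-1) (C i (-1)) (C j (-1)) `|` slice 1 (C i 1) (C j 1)).
  move=> [[[[t zi] zj] xi] xj] [Si Sj].
  by apply: couple_conv_hull_slice1 => //; split; exact: hullS.
(* Only pairs of triangle vertices need checking, as the target is convex. *)
have sliceS s : s = -1 \/ s = 1 -> slice s (C i s) (C j s) `<=`
    conv_hull (couple (SS i) (SS j)).
  move=> s1; apply: slice_conv_hull_sub; first exact: convex_conv_hull.
  move=> [[[[t zi] zj] xi] xj] [-> Vi Vj]; apply: sub_conv_hull; split.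
  - have [LN L1 UN U1] := LU i ii.
    exact: (vertices_sub_unit_set _ _ _ LN L1 UN U1 s (zi, xi)).
  - have [LN L1 UN U1] := LU j jj.
    exact: (vertices_sub_unit_set _ _ _ LN L1 UN U1 s (zj, xj)).
have TS : conv_hull (slice (-1) (C i (-1)) (C j (-1)) `|` slice 1 (C i 1) (C j 1))
    `<=` conv_hull (couple (SS i) (SS j)).
  apply: conv_hull_sub; first exact: convex_conv_hull.
  by move=> p [|]; apply: sliceS; [left|right].
by split; apply/seteqP; split=> // p; [move/GT/TS|move/TS/SG].
Qed.
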